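(* Let $\Lambda$ be a $\sigma$-compact metric space, $X$ a separable Fréchet space and $(T(\lambda))_{\lambda \in \Lambda}$ a continuous family of operators on $X$. Suppose that for any non-empty open subset $V$ of $X$ and for any compact subset $K$ of $\Lambda$ there exists some $\delta > 0$ such that, for any non-empty open subset $U$ of $X$ and any $M \in \mathbb{N}$, there exists $x \in U$ such that for every $\lambda \in K$ there exists $n \geq M$ with $$\frac{\# \{ 0 \leq m \leq n \mid T^m(\lambda)(x) \in V \}}{n + 1} > \delta.$$ Then the set of common upper frequently hypercyclic vectors for $(T(\lambda))_{\lambda \in \Lambda}$ is residual in $X$.
   Context: $\mathbb{N}$ denotes the positive integers and $\mathbb{N}_0$ the nonnegative integers. An operator on a Fréchet space $X$ is a continuous linear map $X \to X$; $T^m(\lambda)$ denotes the $m$-th iterate of $T(\lambda)$. A family of operators $(T(\lambda))_{\lambda \in \Lambda}$ indexed by a metric space $\Lambda$ is called continuous if for any $x \in X$ the map $\Lambda \to X : \lambda \mapsto T(\lambda)(x)$ is continuous on $\Lambda$. The upper density of $A \subset \mathbb{N}_0$ is $\overline{\mathrm{dens}}(A) = \limsup_{n \to \infty} \frac{\#(A \cap [0,n])}{n+1}$. A vector $x \in X$ is upper frequently hypercyclic for an operator $T$ if for any non-empty open subset $U$ of $X$, $\overline{\mathrm{dens}}(\{ m \geq 0 \mid T^m(x) \in U \}) > 0$. A vector is a common upper frequently hypercyclic vector for $(T(\lambda))_{\lambda \in \Lambda}$ if it is upper frequently hypercyclic for $T(\lambda)$ for every $\lambda \in \Lambda$. A set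 is residual if it contains a countable intersection of dense open sets. *)

(* Defs.v *)
From mathcomp Require Import all_boot all_order all_algebra.
From mathcomp Require Import all_classical all_reals all_analysis.
From mathcomp Require Import borel_hierarchy complex.

Set Implicit Arguments.
Unset Strict Implicit.
Unset Printing Implicit Defensive.

Import Order.TTheory GRing.Theory Num.Theory.
Import numFieldNormedType.Exports.

Local Open Scope classical_set_scope.
Local Open Scope ring_scope.

(* The scalar field of a Frechet space is the field of real or of complex
   numbers; both cases are covered by one parameter. *)
Variant scalars := real_scalars | complex_scalars.

Definition scalar_field (R : realType) (s : scalars) : numFieldType :=
  match s with
  | real_scalars => R
  | complex_scalars => R[i]
  end.

(* Completeness is stated through the metric because [tvsType] does not force
   its uniform structure to be the translation-invariant one, so that
   completeness of that uniform structure could be a different notion. *)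
Record complete_invariant_metric (R : realType) (K : numFieldType)
    (X : tvsType K) (d : X -> X -> R) : Prop := {
  cim_refl : forall x, d x x = 0 ;
  cim_separated : forall x y, d x y = 0 -> x = y ;
  cim_sym : forall x y, d x y = d y x ;
  cim_triangle : forall y x z, d x z <= d x y + d y z ;
  cim_invariant : forall z x y, d (x + z) (y + z) = d x y ;
  cim_nbhs : forall x : X,
    nbhs x = filter_from [set e : R | 0 < e] (fun e => [set y | d x y < e]) ;
  cim_complete : forall u : nat -> X,
    (forall e, 0 < e -> exists N, forall m n,
        (N <= m)%N -> (N <= n)%N -> d (u m) (u n) < e) ->
    exists l : X, u @ \oo --> l
}.

(* Local convexity is part of [tvsType]. *)
Definition frechet (R : realType) (K : numFieldType) (X : tvsType K) : Prop :=
  exists d : X -> X -> R, complete_invariant_metric d.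

Definition separable (T : topologicalType) : Prop :=
  exists2 D : set T, countable D & dense D.

Definition sigma_compact (T : topologicalType) : Prop :=
  exists2 F : nat -> set T,
    (forall i, compact (F i)) & \bigcup_i F i = [set: T].

Definition residual (T : topologicalType) (A : set T) : Prop :=
  exists2 G : set T, Gdelta_dense G & G `<=` A.

Definition continuous_family (L X : topologicalType) (T : L -> X -> X) : Prop :=
  forall x : X, continuous (fun l => T l x).

(* #(A `&` [0, n]) / (n + 1) *)
Definition frequency (R : realType) (A : set nat) (n : nat) : R :=
  #|[pred m : 'I_n.+1 | (m : nat) \in A]|%:R / n.+1%:R.

Definition upper_density (R : realType) (A : set nat) : \bar R :=
  limn_esup (fun n => (frequency R A n)%:E).

Definition visits (X : Type) (f : X -> X) (x : X) (U : set X) : set nat :=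
  [set m | U (iter m f x)].

Definition upper_frequently_hypercyclic (R : realType) (X : topologicalType)
    (f : X -> X) (x : X) : Prop :=
  forall U : set X, open U -> U !=set0 ->
    (0 < upper_density R (visits f x U))%E.

Definition common_upper_frequently_hypercyclic (R : realType) (L : Type)
    (X : topologicalType) (T : L -> X -> X) (x : X) : Prop :=
  forall l : L, upper_frequently_hypercyclic R (T l) x.

(* Main.v *)
(* By a Baire category argument (Banach-Steinhaus) the map [(l, x) |-> T l x] is
   jointly continuous, and so are its iterates. Let [V] range over a countable
   base of nonempty open sets and [C] over compact sets covering the parameter
   space, with [delta] the constant given by the hypothesis for [(V, C)]. The set
   of [x] such that for every [l] in [C] some [n > M] has a visit frequency to [V]
   exceeding [delta] is open, because [C] is compact, and dense by hypothesis. Any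
   point in all these sets visits each [V] with upper density at least [delta]
   under every [T l]. *)
Require Import Defs.
From mathcomp Require Import all_boot all_order all_algebra.
From mathcomp Require Import all_classical all_reals all_analysis.
From mathcomp Require Import borel_hierarchy lra.

Set Implicit Arguments.
Unset Strict Implicit.
Unset Printing Implicit Defensive.

Import Order.TTheory GRing.Theory Num.Theory.
Import numFieldNormedType.Exports.

Local Open Scope classical_set_scope.
Local Open Scope ring_scope.

(** * Invariant metrics: Baire category, joint continuity, countable bases *)

Section InvariantMetric.
Context {R : realType} {K : numFieldType} {X : tvsType K} {d : X -> X -> R}.
Hypothesis dX : complete_invariant_metric d.

Lemma cim_sub (x y : X) : d x y = d (x - y) 0.
Proof. by rewrite -(cim_invariant dX (- y)) subrr. Qed.

Lemma cim_nbhsP (x : X) (A : set X) :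
  nbhs x A <-> exists2 e : R, 0 < e & forall y, d x y < e -> A y.
Proof. by rewrite (cim_nbhs dX). Qed.

Lemma cim_near (x : X) (e : R) : 0 < e -> \forall y \near x, d x y < e.
Proof. by move=> e0; apply/cim_nbhsP; exists e. Qed.

Lemma cim_open_ball (x : X) (e : R) : open [set y | d x y < e].
Proof.
rewrite openE => y /= xy; apply/cim_nbhsP; exists (e - d x y); first lra.
move=> z yz /=; have := cim_triangle dX y x z; lra.
Qed.

Lemma cim_closed_le (f g : X -> X) (e : R) : continuous f -> continuous g ->
  closed [set x | d (f x) (g x) <= e].
Proof.
move=> cf cg; rewrite -openC openE => x /= /negP; rewrite -ltNge => ex.
have e0 : 0 < (d (f x) (g x) - e) / 2 by lra.
near=> y.
have fxy : d (f x) (f y) < (d (f x) (g x) - e) / 2.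
  by near: y; exact: (cf x _ (cim_near _ e0)).
have gxy : d (g x) (g y) < (d (f x) (g x) - e) / 2.
  by near: y; exact: (cg x _ (cim_near _ e0)).
apply/negP; rewrite -ltNge.
have := cim_triangle dX (f y) (f x) (g x).
have := cim_triangle dX (g y) (f y) (g x).
rewrite (cim_sym dX (g y)); lra.
Unshelve. all: by end_near. Qed.

(** If no [F n] contained a ball, nested closed balls, the next one missing [F n] at stage [n],
    would have Cauchy centres, with a limit outside every [F n]. *)
Lemma cim_baire (F : nat -> set X) : (forall n, closed (F n)) ->
  \bigcup_n F n = [set: X] ->
  exists n x, exists2 r : R, 0 < r & forall y, d x y < r -> F n y.
Proof.
move=> cF UF; apply: contrapT => noball.
(* Here [p] is a stage with a centre and a radius. Positivity of the radius sits under the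
   existential so that [choice] gives a total function. *)
have step (p : nat * (X * R)) : exists q : X * R, 0 < p.2.2 ->
    [/\ 0 < q.2, q.2 <= p.1.+1%:R^-1 &
     forall z, d q.1 z <= q.2 -> d p.2.1 z <= p.2.2 /\ ~ F p.1 z].
  case: p => n [x r] /=; have [r0|] := ltP 0 r; last first.
    by move=> r0; exists (x, r) => /=; rewrite ltNge r0.
  have r20 : 0 < r / 2 by lra.
  have [y [xy Fy]] : exists y, d x y < r / 2 /\ ~ F n y.
    apply: contrapT => H; apply: noball; exists n, x, (r / 2) => // y xy.
    by apply: contrapT => Fy; apply: H; exists y.
  have /cim_nbhsP [e e0 ye] : nbhs y (~` F n).
    by apply: open_nbhs_nbhs; split => //; rewrite openC.
  (* The three bounds keep the new closed ball inside the old one, keep it off [F n], and send the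
     radii to zero. *)
  exists (y, Num.min (Num.min (r / 2) (e / 2)) n.+1%:R^-1) => /= _; split.
  - by rewrite !lt_min r20 invr_gt0 ltr0n andbT; lra.
  - by rewrite ge_min lexx orbT.
  move=> z; rewrite !le_min => /andP[/andP[zr ze] _]; split.
    have := cim_triangle dX y x z; lra.
  apply: ye; lra.
have {step} [f Hf] := choice step.
pose c := fix c n := if n is k.+1 then f (k, c k) else (0, 1).
have c0 n : 0 < (c n).2 by elim: n => [|n /(Hf (n, _))[]] //=.
have cS n := Hf (n, c n) (c0 n).
have nest m n : (m <= n)%N ->
    forall z, d (c n).1 z <= (c n).2 -> d (c m).1 z <= (c m).2.
  elim: n => [|n IH]; first by rewrite leqn0 => /eqP->.
  rewrite leq_eqVlt => /orP[/eqP->//|/IH{}IH] z.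
  by have [_ _ H] := cS n => /H[/IH].
have cin m n : (m <= n)%N -> d (c m).1 (c n).1 <= (c m).2.
  by move=> mn; apply: (nest _ _ mn); rewrite (cim_refl dX) ltW.
have [l cl] : exists l : X, (fun n => (c n).1) @ \oo --> l.
  apply: (cim_complete dX) => e e0.
  have e20 : 0 < e / 2 by lra.
  have [N _ HN] := near_infty_natSinv_lt (PosNum e20).
  have rN : (c N.+1).2 < e / 2.
    by apply: le_lt_trans (HN N (leqnn N)); have [] := cS N.
  exists N.+1 => m n /cin Nm /cin Nn.
  have := cim_triangle dX (c N.+1).1 (c m).1 (c n).1.
  rewrite (cim_sym dX (c m).1 (c N.+1).1).
  move: (c N.+1) (c m) (c n) Nm Nn rN => q q1 q2; lra.
have lin n : d (c n).1 l <= (c n).2.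
  apply/ler_addgt0Pr => e e0.
  have [N _ HN] := cl _ (cim_near l e0).
  have := HN _ (leq_maxl N n); have := cin _ _ (leq_maxr N n).
  have := cim_triangle dX (c (maxn N n)).1 (c n).1 l.
  rewrite /= (cim_sym dX l); lra.
have [n _ Fl] : (\bigcup_n F n) l by rewrite UF.
by have [_ _ /(_ l (lin n.+1))[]] := cS n.
Qed.

(* Baire gives a ball of points [x] on which [T l x] is uniformly close to
   [T l0 x] for [l] near [l0]; by linearity the ball may be centred at [0]. *)
Lemma joint_continuity (L : pseudoMetricType R) (T : L -> {linear X -> X}) :
  (forall l, continuous (T l)) -> continuous_family (fun l => T l : X -> X) ->
  continuous (fun p : L * X => T p.1 p.2).
Proof.
move=> cT cF [l0 x0] /= A /cim_nbhsP [e e0 eA].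
have e5 : 0 < e / 5 by lra.
(* Continuity of each operator makes [E n] closed; pointwise continuity of the family makes the
   [E n] cover [X]. *)
pose E n :=
  [set x | forall l, ball l0 n.+1%:R^-1 l -> d (T l0 x) (T l x) <= e / 5].
have cE n : closed (E n).
  rewrite (_ : E n = \bigcap_(l in ball l0 n.+1%:R^-1)
      [set x | d (T l0 x) (T l x) <= e / 5]) //.
  by apply: closed_bigI => l _; exact: cim_closed_le.
have UE : \bigcup_n E n = [set: X].
  apply/seteqP; split => // x _.
  have /nbhs_ballP [r /= r0 rT] := cF x l0 _ (cim_near (T l0 x) e5).
  have [N _ HN] := near_infty_natSinv_lt (PosNum r0).
  exists N => // l lN; apply/ltW/rT.
  by apply: le_ball lN; apply/ltW/(HN N (leqnn N)).
have [n [x1 [r r0 rE]]] := cim_baire cE UE.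
(* Subtract the estimates at [x1 + h] and [x1]; each costs [e / 5]. *)
have small h l : d h 0 < r -> ball l0 n.+1%:R^-1 l ->
    d (T l0 h) (T l h) <= e / 5 + e / 5.
  move=> hr ln.
  have x1h : d x1 (x1 + h) < r.
    by rewrite cim_sym // -(cim_invariant dX (- x1)) subrr addrAC subrr add0r.
  have := rE _ x1h l ln; have := rE x1 _ l ln; rewrite (cim_refl dX) => /(_ r0).
  rewrite cim_sub => D1; rewrite cim_sub !linearD/= addrACA => D2.
  rewrite cim_sub -(cim_invariant dX (T l0 x1 - T l x1)) add0r addrC.
  apply: le_trans (cim_triangle dX 0 _ _) _; rewrite (cim_sym dX 0); lra.
have near1 (P : set L) : nbhs l0 P -> \forall p \near (l0, x0), P p.1.
  exact: (@cvg_fst _ _ (nbhs l0) (nbhs x0)).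
have near2 (P : set X) : nbhs x0 P -> \forall p \near (l0, x0), P p.2.
  exact: (@cvg_snd _ _ (nbhs l0) (nbhs x0)).
change (\forall p \near (l0, x0), A (T p.1 p.2)); near=> p.
have p1 : ball l0 n.+1%:R^-1 p.1 by near: p; apply: near1; exact: near_ball.
have p2 : d x0 p.2 < r by near: p; exact: (near2 _ (cim_near x0 r0)).
have Tp1 : d (T l0 x0) (T p.1 x0) < e / 5.
  by near: p; exact: (near1 _ (cF x0 l0 _ (cim_near _ e5))).
have Tp2 : d (T l0 x0) (T l0 p.2) < e / 5.
  by near: p; exact: (near2 _ (cT l0 x0 _ (cim_near _ e5))).
apply: eA => /=.
have := small (p.2 - x0) p.1; rewrite -cim_sub (cim_sym dX p.2) => /(_ p2 p1).
rewrite !linearB /= => D0.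
(* The path from [T l0 x0] to [T p.1 p.2] goes through [T l0 p.2] and
   [T p.1 p.2 - T p.1 x0 + T l0 x0]; its legs, bounded by [Tp2], [D0] and [Tp1], total less than
   [4 * e / 5]. *)
have := cim_invariant dX (T l0 x0) (T l0 p.2 - T l0 x0) (T p.1 p.2 - T p.1 x0).
have := cim_invariant dX (T p.1 p.2 - T p.1 x0) (T l0 x0) (T p.1 x0).
rewrite subrK [T p.1 x0 + _]addrC subrK [T l0 x0 + _]addrC => E1 E2.
have := cim_triangle dX (T p.1 p.2 - T p.1 x0 + T l0 x0) (T l0 p.2) (T p.1 p.2).
have := cim_triangle dX (T l0 p.2) (T l0 x0) (T p.1 p.2).
lra.
Unshelve. all: by end_near. Qed.
(** Balls of radius [1 / (k + 1)] about a dense sequence. Having some [B i] inside [U] is enough,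
    since visits to [B i] are visits to [U]. *)
Lemma cim_separable_base : separable X -> exists B : nat * nat -> set X,
  (forall i, open (B i) /\ B i !=set0) /\
  forall U : set X, open U -> U !=set0 -> exists i, B i `<=` U.
Proof.
move=> [D /pfcard_geP[D0|[g]] dD].
  by have [|x []] := dD setT _ openT; [exists 0|rewrite D0].
exists (fun i => [set y | d (g i.1) y < i.2.+1%:R^-1]).
split => [[j k]|U oU [x Ux]].
  split; first exact: cim_open_ball.
  by exists (g j); rewrite /= (cim_refl dX) invr_gt0.
have /cim_nbhsP [e e0 eU] : nbhs x U by exact: open_nbhs_nbhs.
have e20 : 0 < e / 2 by lra.
have [k _ /(_ k (leqnn k)) /= ke] := near_infty_natSinv_lt (PosNum e20).
have [|z [/= xz Dz]] := dD [set y | d x y < k.+1%:R^-1] _ (cim_open_ball _ _).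
  by exists x; rewrite /= (cim_refl dX) invr_gt0.
have [j _ gj] : (g @` setT) z by exact: (@surj _ _ _ _ g).
exists (j, k) => y /=; rewrite gj => zy; apply: eU.
apply: le_lt_trans (cim_triangle dX z x y) _.
by rewrite [e]splitr; apply: ltrD; [apply: lt_trans xz _|apply: lt_trans zy _].
Qed.

End InvariantMetric.

(** * Visit frequencies, upper density and dense G-delta sets *)

Lemma frequency_le (R : realType) (A B : set nat) (n : nat) :
  (forall m, (m <= n)%N -> A m -> B m) -> frequency R A n <= frequency R B n.
Proof.
move=> AB; apply: ler_wpM2r; first by rewrite invr_ge0 ler0n.
rewrite ler_nat; apply/subset_leq_card/fintype.subsetP => m; rewrite !inE.
by apply: AB; rewrite -ltnS.
Qed.

Lemma lt_frequency_upper_density (R : realType) (A : set nat) (e : R) :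
  (forall M, exists2 n, (M <= n)%N & e < frequency R A n) ->
  (e%:E <= upper_density R A)%E.
Proof.
move=> eA; apply: le_ereal_inf_tmp => _ [S [N _ NS] <-].
have [n Nn en] := eA N.
apply: (@le_trans _ _ (frequency R A n)%:E); first by rewrite lee_fin ltW.
by apply: ereal_sup_ubound; exists n => //; exact: NS.
Qed.

Lemma Gdelta_dense_bigcap (I : countType) (X : topologicalType)
    (F : I -> set X) : (forall i, open (F i) /\ dense (F i)) ->
  Gdelta_dense (\bigcap_i F i).
Proof.
(* Numbers coding no index contribute the whole space, which is open and dense. *)
move=> oF; exists (fun n => if unpickle n is Some i then F i else setT).
  move=> n; case: unpickle => //.
  by split; [exact: openT|move=> U [x Ux] _; exists x].
apply/seteqP; split => x Fx; first by move=> n _; case: unpickle => // i; exact: Fx.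
by move=> i _; have := Fx (pickle i) Logic.I; rewrite pickleK.
Qed.

(** * Open conditions on orbits, uniform over compact parameter sets *)

Section ContinuousFamily.
Context {L X : topologicalType} (f : L -> X -> X).
Hypothesis cf : continuous (fun p : L * X => f p.1 p.2).

Lemma iter_joint_continuous m :
  continuous (fun p : L * X => iter m (f p.1) p.2).
Proof.
elim: m => [|m IH] p /=; first exact: cvg_snd.
apply: (@continuous_comp _ _ _
  (fun q : L * X => (q.1, iter m (f q.1) q.2)) (fun q => f q.1 q.2)).
  by apply: cvg_pair; [exact: cvg_fst|exact: IH].
exact: cf.
Qed.

(** Each of the finitely many visits up to time [n] persists under small perturbation, so the
    frequency cannot drop locally. *)
Lemma open_lt_frequency (R : realType) (V : set X) (e : R) (n : nat) :
  open V -> open [set p : L * X | e < frequency R (visits (f p.1) p.2 V) n].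
Proof.
move=> oV; rewrite openE => p /= ep.
have near_visits m : nbhs p [set q |
    visits (f p.1) p.2 V m -> visits (f q.1) q.2 V m].
  have [Vm|nVm] := pselect (visits (f p.1) p.2 V m).
    have Vp : nbhs (iter m (f p.1) p.2) V by exact: open_nbhs_nbhs.
    have : nbhs p [set q | V (iter m (f q.1) q.2)].
      exact: (@iter_joint_continuous m p _ Vp).
    by apply: filterS => q Vq.
  by apply: (nearW (F := nbhs p)) => q.
have := @filter_forall _ 'I_n.+1 _ (nbhs p) (nbhs_filter p)
  (fun m => near_visits m).
apply: filterS => q pq /=; apply: (lt_le_trans ep); apply: frequency_le => m mn.
exact: (pq (Ordinal (mn : (m < n.+1)%N))).
Qed.

End ContinuousFamily.

(** The tube lemma, read off the near-covering form of compactness. *)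
Lemma open_forall_compact (L X : topologicalType) (K : set L)
    (W : set (L * X)) : compact K -> open W ->
  open [set x | forall l, K l -> W (l, x)].
Proof.
move=> /compact_near_coveringP cK; rewrite !openE => oW x /= Kx.
apply: (cK X (nbhs x) (fun y l => W (l, y))) => l /Kx /oW[AB ABlx ABW].
by exists AB => // -[u v] /ABW.
Qed.

Theorem theorem1 (R : realType) (s : scalars) (L : metricType R)
    (X : tvsType (scalar_field R s)) (T : L -> {linear X -> X}) :
  sigma_compact L ->
  frechet R X ->
  separable X ->
  (forall l, continuous (T l)) ->
  continuous_family (fun l => T l : X -> X) ->
  (forall (V : set X) (K : set L), open V -> V !=set0 -> compact K ->
     exists2 delta : R, 0 < delta &
       forall (U : set X) (M : nat), open U -> U !=set0 -> (0 < M)%N ->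
         exists2 x : X, U x &
           forall l : L, K l ->
             exists2 n : nat, (M <= n)%N &
               delta < frequency R (visits (T l) x V) n) ->
  residual [set x : X |
    common_upper_frequently_hypercyclic R (fun l => T l : X -> X) x].
Proof.
move=> [C cC UC] [d dX] sX cT cF H.
have [B [oB BU]] := cim_separable_base dX sX.
have {}H (i : nat * (nat * nat)) : exists e : R, 0 < e /\
    forall (U : set X) (M : nat), open U -> U !=set0 -> (0 < M)%N ->
    exists2 x : X, U x & forall l : L, C i.1 l ->
      exists2 n : nat, (M <= n)%N & e < frequency R (visits (T l) x (B i.2)) n.
  by have [e e0 He] := H _ _ (oB i.2).1 (oB i.2).2 (cC i.1); exists e.
(* The constant depends on the compact set and the base set only, not on [U] or [M]; this is what
   bounds the upper density below. *)
have {H} [e He] := choice H.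
(* The index [j] codes a compact set, a base set and a threshold; the successor makes the threshold
   positive, as the hypothesis requires. *)
pose F (j : nat * (nat * nat) * nat) := [set x : X | forall l, C j.1.1 l ->
  [set p : L * X | exists2 n, (j.2.+1 <= n)%N &
     e j.1 < frequency R (visits (T p.1) p.2 (B j.1.2)) n] (l, x)].
exists (\bigcap_j F j).
  apply: Gdelta_dense_bigcap => -[i M]; split.
    apply: open_forall_compact => //=.
    rewrite [X in open X](_ : _ = \bigcup_(n in [set n | (M.+1 <= n)%N])
        [set p : L * X | e i < frequency R (visits (T p.1) p.2 (B i.2)) n]).
      apply: bigcup_open => n _.
      apply: (@open_lt_frequency L X (fun l => T l)) (oB _).1.
      exact: joint_continuity dX L T cT cF.
    by apply/seteqP; split.
  move=> U U0 oU; have [x Ux xF] := (He i).2 U M.+1 oU U0 isT.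
  by exists x.
move=> x Fx l U oU U0; have [b bU] := BU U oU U0.
have [a _ Cl] : (\bigcup_a C a) l by rewrite UC.
apply: (@lt_le_trans _ _ (e (a, b))%:E); first by rewrite lte_fin (He _).1.
apply: lt_frequency_upper_density => M.
have [n Mn en] := Fx ((a, b), M) I l Cl; exists n; first exact: ltnW.
apply: (lt_le_trans en); apply: frequency_le => m _ /=; exact: bU.
Qed.
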